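(* Let $m$ be a nonnegative integer and let $G$ be a graph with two edge-disjoint loopless factors $M$ and $M_0$ satisfying $\Delta(M)\le m$ and $|E(M_0)|\le m$. If $G$ is $2m$-edge-connected, then $G$ has an $m$-tree-connected factor $H$ containing all edges of $M$ and no edges of $M_0$ such that $G\setminus E(H\cup M_0)$ is $(0,l)$-partition-connected, where $l(v)= \lfloor d_{G}(v)/2\rfloor-m$ for each vertex $v$. Furthermore, for an arbitrary given vertex $z$, $H$ can be chosen so that the same holds with $l(z)=\lceil d_{G}(z)/2\rceil -m$ (and $l(v)=\lfloor d_G(v)/2\rfloor-m$ for $v\neq z$).
   Context: Graphs may have loops and multiple edges. A factor of $G$ is a spanning subgraph; $\Delta(M)$ is the maximum degree of $M$. A graph is $m$-tree-connected if it contains $m$ edge-disjoint spanning trees. For an integer-valued function $l$ on $V(G)$, a graph is $(m,l)$-partition-connected if its edge set can be decomposed into an $m$-tree-connected factor and a factor $F$ which admits an orientation such that $d^+_F(v)\ge l(v)$ for each vertex $v$ (out-degree). In particular, $(0,l)$-partition-connected means the graph has an orientation with out-degree at least $l(v)$ at each vertex $v$. *)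

(* Defs.v *)
From mathcomp Require Import all_boot all_order all_algebra.

Set Implicit Arguments.
Unset Strict Implicit.
Unset Printing Implicit Defensive.

(* Finite undirected multigraphs; loops are the edges with both ends equal.
   The order of the two ends of an edge carries no meaning: every notion below
   is invariant under swapping the components of [ends e]. *)
Record mgraph := MGraph {
  vertex : finType;
  edge : finType;
  ends : edge -> vertex * vertex
}.

(* A factor (spanning subgraph) of G is identified with its edge set. *)
Notation factor G := {set edge G}.

Section Defs.
Variable G : mgraph.
Implicit Types (F H S T : factor G) (u v x : vertex G) (e : edge G).

Definition joins e u v : bool := (ends e == (u, v)) || (ends e == (v, u)).

Definition is_loop e : bool := (ends e).1 == (ends e).2.

Definition loopless F : Prop := forall e, e \in F -> ~~ is_loop e.

(* A loop contributes 2 to the degree of its end. *)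
Definition degree F v : nat :=
  \sum_(e in F) (((ends e).1 == v) + ((ends e).2 == v)).

Definition max_degree F : nat := \max_(v : vertex G) degree F v.

Definition adjacent F u v : bool := [exists e in F, joins e u v].

Definition connected F : Prop := forall u v, connect (adjacent F) u v.

Definition edge_connected (k : nat) : Prop :=
  forall S, #|S| < k -> connected (~: S).

(* A walk from x is given by its successive (edge, next vertex) steps. *)
Fixpoint walk F x (p : seq (edge G * vertex G)) : bool :=
  if p is (e, y) :: p' then [&& e \in F, joins e x y & walk F y p'] else true.

(* Loops are cycles of length 1, pairs of parallel edges cycles of length 2. *)
Definition is_cycle F x (p : seq (edge G * vertex G)) : bool :=
  [&& p != [::], walk F x p, last x (unzip2 p) == x,
      uniq (unzip1 p) & uniq (unzip2 p)].

Definition acyclic F : Prop := forall x p, ~~ is_cycle F x p.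

Definition spanning_tree T : Prop := connected T /\ acyclic T.

Definition tree_connected (m : nat) F : Prop :=
  exists T : 'I_m -> factor G,
    (forall i, T i \subset F /\ spanning_tree (T i)) /\
    (forall i j, i != j -> [disjoint T i & T j]).

(* D e is the pair (tail, head) of e; its values outside F are irrelevant. *)
Definition orientation F (D : edge G -> vertex G * vertex G) : Prop :=
  forall e, e \in F -> joins e (D e).1 (D e).2.

Definition out_degree F (D : edge G -> vertex G * vertex G) v : nat :=
  #|[set e in F | (D e).1 == v]|.

Definition partition_connected (m : nat) (l : vertex G -> int) F : Prop :=
  exists A B : factor G,
    [/\ A :|: B = F, [disjoint A & B], tree_connected m A &
        exists D, orientation B D /\
          forall v, (l v <= (out_degree B D v)%:Z)%R].

End Defs.

Arguments edge_connected : clear implicits.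

(* Main.v *)
(** By Rado's theorem on independent transversals, the edge set can be split
    into parts, the k-th one independent for a polymatroid f_k, as soon as |J| is
    at most the sum over k of f_k(J) for every set J of edges.  Apply this to m
    copies of the graphic matroid of G without M0, to a polymatroid of rank l(v)
    for each vertex v, charged by the edges at v outside M and M0, and to a bin
    for the left-over edges.  The ranks add up to |E(G)|, so every part is filled
    exactly: the graphic parts are connected and v receives l(v) outgoing edges.
    The condition to check is, for J disjoint from M0 with c(J) components,
      |J| + |M0| + m c(J) + l(Y) <= |E(G)| + m,
    where Y is the set of vertices met by no edge of J outside M.  As M has
    maximum degree at most m, one may assume that J isolates the vertices of Y;
    then sum the degrees outside J over the components of J, each of which has
    at least 2m leaving edges. *)
From HB Require Import structures.
Require Import Defs.
From mathcomp Require Import all_boot all_order all_algebra.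
From mathcomp Require Import zify.
Set Implicit Arguments.
Unset Strict Implicit.
Unset Printing Implicit Defensive.

Lemma eq_of_leq_sum (I : finType) (E1 E2 : I -> nat) :
    (forall i, E1 i <= E2 i) -> \sum_i E2 i <= \sum_i E1 i ->
  forall i, E1 i = E2 i.
Proof.
move=> le12 le21 i; apply/eqP.
have := leqif_sum (fun i (_ : true) => leqif_eq (le12 i)).
by move/geq_leqif; rewrite le21 => /esym/forallP/(_ i).
Qed.

Lemma sum_card_fibers (E K : finType) (c : E -> K) :
  \sum_k #|c @^-1: [set k]| = #|E|.
Proof.
rewrite -sum1_card (partition_big c xpredT) //; apply: eq_bigr => k _.
by rewrite -sum1dep_card; apply: eq_bigl => e; rewrite !inE.
Qed.

Lemma sum_option (I : finType) (F : option I -> nat) :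
  \sum_o F o = F None + \sum_i F (Some i).
Proof.
rewrite (bigD1 None) //= (reindex_omap Some id) => [|[]] //=.
by congr addn; apply: eq_bigl => i; rewrite eqxx.
Qed.

Section Polymatroid.
Variable S : finType.
Implicit Types (f : {set S} -> nat) (U W B : {set S}).

Definition monotone f : Prop := forall U W, U \subset W -> f U <= f W.

Definition submodular f : Prop :=
  forall U W, f (U :|: W) + f (U :&: W) <= f U + f W.

Definition polymatroid f : Prop := [/\ f set0 = 0, monotone f & submodular f].

Lemma polymatroid_sum (I : finType) (f : I -> {set S} -> nat) :
  (forall i, polymatroid (f i)) -> polymatroid (fun U => \sum_i f i U).
Proof.
move=> polyf; split.
- by apply: big1 => i _; case: (polyf i).
- by move=> U W sUW; apply: leq_sum => i _; case: (polyf i) => _ /(_ U W sUW).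
by move=> U W; rewrite -!big_split; apply: leq_sum => i _; case: (polyf i).
Qed.

Lemma polymatroid_setD B f :
  polymatroid f -> polymatroid (fun U => f (U :\: B)).
Proof.
case=> f0 f_mono f_submod; split; first by rewrite set0D.
- by move=> U W sUW; apply/f_mono/setSD.
by move=> U W; rewrite setDUl setDIl.
Qed.

Definition meets B U : bool := B :&: U != set0.

Lemma polymatroid_meets n B : polymatroid (fun U => n * meets B U).
Proof.
have mono U W : U \subset W -> meets B U <= meets B W.
  move=> sUW; rewrite /meets -!card_gt0.
  by have := subset_leq_card (setIS B sUW); lia.
split=> [|U W /mono|U W]; first by rewrite /meets setI0 eqxx muln0.
  exact: leq_mul.
rewrite -!mulnDr leq_mul //.
have := mono _ _ (subsetIl U W); have := mono _ _ (subsetIr U W).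
rewrite /meets setIUr setU_eq0 negb_and.
by do 3!case: (_ == set0).
Qed.

End Polymatroid.

Lemma polymatroid_preimset (S T : finType) (h : T -> S) (f : {set T} -> nat) :
  polymatroid f -> polymatroid (fun U => f (h @^-1: U)).
Proof.
case=> f0 f_mono f_submod; split; first by rewrite preimset0.
- by move=> U W /preimsetS/f_mono.
by move=> U W; rewrite preimsetU preimsetI.
Qed.

Section Rado.
Variables (S E : finType) (f : {set S} -> nat).
Hypothesis polyf : polymatroid f.
Implicit Types (A : E -> {set S}) (J K : {set E}).

Definition hall A : Prop := forall J, #|J| <= f (\bigcup_(e in J) A e).

Definition discard A e s i : {set S} := if i == e then A e :\ s else A i.

Lemma discard_sub A e s i : discard A e s i \subset A i.
Proof. by rewrite /discard; case: eqP => [->|//]; apply: subsetDl. Qed.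

Lemma bigcup_discard A e s J : e \in J ->
  \bigcup_(i in J) discard A e s i = A e :\ s :|: \bigcup_(i in J :\ e) A i.
Proof.
move=> eJ; rewrite (big_setD1 e) //= /discard eqxx; congr (_ :|: _).
by apply: eq_bigr => i; rewrite !inE => /andP[/negPf->].
Qed.

Lemma mem_discard_violation A e s J : hall A ->
  f (\bigcup_(i in J) discard A e s i) < #|J| -> e \in J.
Proof.
move=> hallA; apply: contraLR => eJ; rewrite -leqNgt.
rewrite (eq_bigr A) ?hallA // => i iJ.
by rewrite /discard; case: eqP => // ie; rewrite -ie iJ in eJ.
Qed.

(* If discarding s and discarding t both broke Hall's condition, the two
   violating sets would contradict submodularity. *)
Lemma hall_discard A e s t : s != t -> hall A ->
  hall (discard A e s) \/ hall (discard A e t).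
Proof.
move=> nst hallA; case: polyf => _ f_mono f_submod.
pose union r J := \bigcup_(i in J) discard A e r i.
have [J badJ|hall_s] := pickP (fun J : {set E} => f (union s J) < #|J|);
  last first.
  by left=> J; rewrite leqNgt; apply/negbT/hall_s.
have [K badK|hall_t] := pickP (fun K : {set E} => f (union t K) < #|K|);
  last first.
  by right=> K; rewrite leqNgt; apply/negbT/hall_t.
have eJ := mem_discard_violation hallA badJ.
have eK := mem_discard_violation hallA badK.
have leU : #|J :|: K| <= f (union s J :|: union t K).
  apply: leq_trans (hallA _) (f_mono _ _ _).
  rewrite /union (bigcup_discard A s eJ) (bigcup_discard A t eK).
  rewrite bigcup_setU (big_setD1 e eJ) (big_setD1 e eK) /=.
  apply/subsetP=> r; rewrite !inE; have [->|_] := eqVneq r s; rewrite ?nst;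
    by case: (_ \in A e); rewrite /= ?andbF ?orbT.
have leI : #|(J :&: K) :\ e| <= f (union s J :&: union t K).
  apply: leq_trans (hallA _) (f_mono _ _ _); apply/bigcupsP=> i.
  rewrite !inE => /and3P[ie iJ iK]; rewrite /union.
  rewrite (bigcup_discard A s eJ) (bigcup_discard A t eK).
  by rewrite subsetI !subsetU // (bigcup_sup i) ?orbT // !inE ie ?iJ ?iK.
have eJK : e \in J :&: K by rewrite inE eJ.
have := f_submod (union s J) (union t K).
have := cardsUI J K; rewrite (cardsD1 e (J :&: K)) eJK.
by move: leU leI; rewrite /union in badJ badK *; lia.
Qed.

Lemma hall_neq0 A e : hall A -> A e != set0.
Proof.
case: polyf => f0 _ _ /(_ [set e]).
by rewrite big_set1 cards1; case: eqP => // ->; rewrite f0.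
Qed.

Theorem rado_transversal A : hall A ->
  exists x : E -> S,
    (forall e, x e \in A e) /\ (forall J, #|J| <= f (x @: J)).
Proof.
have [k] := ubnP (\sum_e #|A e|); elim: k => // k IHk in A * => ltk hallA.
have [e /card_gt1P[s [t [sA tA nst]]]|le1] := pickP (fun e => 1 < #|A e|).
  have [r rA hallr] : exists2 r, r \in A e & hall (discard A e r).
    by case: (hall_discard e nst hallA); [exists s | exists t].
  have lt_discard : \sum_i #|discard A e r i| < k.
    apply: leq_trans (_ : \sum_i #|A i| <= k); last by rewrite -ltnS.
    rewrite (bigD1 e) //= [X in _ < X](bigD1 e) //= {1}/discard eqxx.
    rewrite (cardsD1 r (A e)) rA add1n addSn ltnS leq_add2l.
    by apply: leq_sum => i _; apply/subset_leq_card/discard_sub.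
  have [x [xA rankx]] := IHk _ lt_discard hallr.
  by exists x; split=> // i; apply: (subsetP (discard_sub A e r i)).
have /fin_all_exists[x Ax] e : exists s, A e = [set s].
  apply/cards1P; have := hall_neq0 e hallA.
  by move: (le1 e); rewrite -card_gt0; lia.
exists x; split=> [e|J]; first by rewrite Ax set11.
rewrite (leq_trans (hallA J)) //; case: polyf => _ f_mono _; apply: f_mono.
by apply/bigcupsP=> e eJ; rewrite Ax sub1set imset_f.
Qed.

End Rado.

(* Rado's theorem on the slots (k, e), of which e may use those with last
   component e. *)
Lemma polymatroid_partition (E K : finType) (f : K -> {set E} -> nat) :
    (forall k, polymatroid (f k)) ->
    (forall J : {set E}, #|J| <= \sum_k f k J) ->
  exists c : E -> K,
    forall k (J : {set E}), J \subset c @^-1: [set k] -> #|J| <= f k J.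
Proof.
move=> polyf le_sum.
pose F (U : {set K * E}) := \sum_k f k (pair k @^-1: U).
have polyF : polymatroid F.
  by apply: polymatroid_sum => k; apply: polymatroid_preimset.
have hallF : hall F (fun e : E => [set s : K * E | s.2 == e]).
  move=> J; rewrite (_ : \bigcup_(e in J) _ = [set s | s.2 \in J]); last first.
    apply/setP=> s; rewrite inE; apply/bigcupP/idP => [[e eJ]|sJ].
      by rewrite inE => /eqP->.
    by exists s.2; rewrite ?inE.
  have fiber k : pair k @^-1: [set s : K * E | s.2 \in J] = J.
    by apply/setP=> e; rewrite !inE.
  by rewrite /F; under eq_bigr => k _ do rewrite fiber.
have [x [xE rankx]] := rado_transversal polyF hallF.
have {}xE e : (x e).2 = e by apply/eqP; have := xE e; rewrite inE.
exists (fun e => (x e).1) => k J /subsetP Jk.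
have {}Jk e : e \in J -> x e = (k, e).
  by move/Jk; rewrite !inE => /eqP ck; rewrite [x e]surjective_pairing ck xE.
apply: leq_trans (rankx J) _; rewrite /F (bigD1 k) //= big1 => [|l nlk].
  rewrite addn0; case: (polyf k) => _ f_mono _; apply: f_mono.
  by apply/subsetP=> e; rewrite inE => /imsetP[e' /[dup] e'J /Jk-> [->]].
case: (polyf l) => f0 f_mono _; apply/eqP; rewrite -leqn0 -f0; apply: f_mono.
apply/subsetP=> e; rewrite inE => /imsetP[e' /Jk-> [lk _]].
by rewrite lk eqxx in nlk.
Qed.

Section Incidence.
Variable G : mgraph.
Implicit Types (J K : factor G) (u v : vertex G) (e : edge G).

Definition incident e v : bool := ((ends e).1 == v) || ((ends e).2 == v).

Definition star J v : factor G := [set e in J | incident e v].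

Definition isolated J v : bool := star J v == set0.

Lemma star_sub J v : star J v \subset J.
Proof. by apply/subsetP=> e; rewrite inE => /andP[]. Qed.

Lemma isolatedP J v :
  reflect (forall e, e \in J -> ~~ incident e v) (isolated J v).
Proof.
apply: (iffP eqP) => [Jv e eJ|h].
  by have := in_set0 e; rewrite -Jv inE eJ /= => ->.
by apply/setP=> e; rewrite !inE; apply/negP=> /andP[/h/negPf->].
Qed.

Lemma isolatedS J K v : J \subset K -> isolated K v -> isolated J v.
Proof. by move=> /subsetP sJK /isolatedP h; apply/isolatedP=> e /sJK/h. Qed.

Lemma meets_star J K v : meets (star K v) J = ~~ isolated (J :&: K) v.
Proof.
congr (~~ (_ == _)); apply/setP=> e.
by rewrite !inE; case: (e \in J); case: (e \in K); rewrite ?andbT ?andbF.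
Qed.

Lemma adjacentP J u v :
  reflect (exists2 e, e \in J & ends e = (u, v) \/ ends e = (v, u))
          (adjacent J u v).
Proof.
apply: (iffP existsP) => [[e /andP[eJ]]|[e eJ h]].
  by case/orP=> /eqP; exists e; auto.
by exists e; rewrite eJ /joins; case: h => ->; rewrite eqxx ?orbT.
Qed.

Lemma adjacent_ends J e : e \in J -> adjacent J (ends e).1 (ends e).2.
Proof.
by move=> eJ; apply/adjacentP; exists e; rewrite // -surjective_pairing; left.
Qed.

Lemma connect_adjacent_sym J : connect_sym (adjacent J).
Proof.
apply: sym_connect_sym => u v.
by apply: eq_existsb => e; rewrite /joins orbC.
Qed.

Lemma connect_isolated J u v :
  isolated J v -> connect (adjacent J) u v -> u = v.
Proof.
move=> /isolatedP Jv; have cl : closed (adjacent J) (pred1 v).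
  move=> x y /adjacentP[e /Jv + E]; rewrite /incident !inE negb_or.
  by case: E => -> /andP[/negPf-> /negPf->].
by move/(closed_connect cl); rewrite !inE eqxx => /eqP.
Qed.

End Incidence.

Section Components.
Variable G : mgraph.
Implicit Types (J K : factor G) (u v : vertex G) (e : edge G).

Definition ncomp J : nat := #|roots (adjacent J)|.

Lemma root_in_roots J v :
  fingraph.root (adjacent J) v \in roots (adjacent J).
Proof. exact/roots_root/connect_adjacent_sym. Qed.

Lemma root_adjacentP J u v :
  reflect (fingraph.root (adjacent J) u = fingraph.root (adjacent J) v)
          (connect (adjacent J) u v).
Proof. exact/fingraph.rootP/connect_adjacent_sym. Qed.

Lemma root_ends J e : e \in J ->
  fingraph.root (adjacent J) (ends e).1 = fingraph.root (adjacent J) (ends e).2.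
Proof. by move=> eJ; apply/root_adjacentP/connect1/adjacent_ends. Qed.

Lemma root_isolated J v : isolated J v -> fingraph.root (adjacent J) v = v.
Proof.
move=> Jv; apply: (connect_isolated Jv).
by rewrite connect_adjacent_sym connect_root.
Qed.

Lemma ncomp0 : ncomp set0 = #|vertex G|.
Proof.
apply: eq_card => v; rewrite inE; apply/eqP/root_isolated/isolatedP => e.
by rewrite inE.
Qed.

Lemma ncomp_gt0 J v : 0 < ncomp J.
Proof.
by apply/card_gt0P; exists (fingraph.root (adjacent J) v); apply: root_in_roots.
Qed.

Lemma ncomp_le1_connected J : ncomp J <= 1 -> connected J.
Proof.
move=> le1 u v; apply/root_adjacentP.
by apply: (card_le1_eqP le1); apply: root_in_roots.
Qed.

(* Counting components as the dimension of a space of functions turns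
   supermodularity into the dimension formula for a sum of subspaces. *)
Definition potential := {ffun vertex G -> rat^o}.

Definition component J v : {r | r \in roots (adjacent J)} :=
  Sub (fingraph.root (adjacent J) v) (root_in_roots J v).

Definition lift_components J
    (phi : {ffun {r | r \in roots (adjacent J)} -> rat^o}) : potential :=
  [ffun v => phi (component J v)].

Lemma lift_components_is_linear J : linear (@lift_components J).
Proof. by move=> a phi psi; apply/ffunP=> v; rewrite !ffunE. Qed.
HB.instance Definition _ J :=
  GRing.isLinear.Build rat _ potential _ (@lift_components J)
    (@lift_components_is_linear J).

Definition loc_const J : {vspace potential} :=
  limg (linfun (@lift_components J)).

Lemma loc_constP J (phi : potential) :
  reflect (forall e, e \in J -> phi (ends e).1 = phi (ends e).2)
          (phi \in loc_const J).
Proof.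
apply: (iffP memv_imgP) => [[psi _ ->] e eJ|constJ].
  rewrite lfunE !ffunE; congr (psi _).
  by apply/val_inj/root_ends.
exists [ffun r => phi (val r)]; first exact: memvf.
have cl u : closed (adjacent J) [pred v | phi v == phi u].
  by move=> x y /adjacentP[e /constJ + [] E]; rewrite E !inE /= => ->.
apply/ffunP=> v; rewrite lfunE !ffunE /=; apply/esym/eqP.
by have := closed_connect (cl v) (connect_root _ v); rewrite !inE eqxx => <-.
Qed.

Lemma dim_loc_const J : \dim (loc_const J) = ncomp J.
Proof.
have component_val r : component J (val r) = r by exact/val_inj/eqP/(valP r).
have /lker0P/eqP ker0 : injective (linfun (@lift_components J)).
  move=> phi psi /ffunP eq_lift; apply/ffunP=> r; move: (eq_lift (val r)).
  by rewrite !lfunE !ffunE component_val.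
rewrite /loc_const limg_dim_eq ?ker0 ?capv0 //.
by rewrite dimvf /dim /= muln1 card_sig.
Qed.

Lemma loc_constS J K : J \subset K -> (loc_const K <= loc_const J)%VS.
Proof.
move=> /subsetP sJK; apply/subvP=> phi /loc_constP constK.
by apply/loc_constP=> e /sJK/constK.
Qed.

Lemma loc_constU J K : loc_const (J :|: K) = (loc_const J :&: loc_const K)%VS.
Proof.
apply/eqP; rewrite eqEsubv subv_cap !loc_constS ?subsetUl ?subsetUr //=.
apply/subvP=> phi; rewrite memv_cap => /andP[/loc_constP cJ /loc_constP cK].
by apply/loc_constP=> e; rewrite inE => /orP[/cJ|/cK].
Qed.

Lemma ncompS J K : J \subset K -> ncomp K <= ncomp J.
Proof. by move/loc_constS/dimvS; rewrite !dim_loc_const. Qed.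

Lemma ncomp_le J : ncomp J <= #|vertex G|.
Proof. exact: max_card. Qed.

Lemma ncomp_supermod J K :
  ncomp J + ncomp K <= ncomp (J :|: K) + ncomp (J :&: K).
Proof.
rewrite -!dim_loc_const loc_constU -dimv_sum_cap addnC leq_add2l dimvS //.
by rewrite subv_add !loc_constS ?subsetIl ?subsetIr.
Qed.

Lemma ncomp_isolate J v e : e \in star J v -> ~~ is_loop e ->
  ncomp J < ncomp (J :\: star J v).
Proof.
rewrite inE => /andP[eJ inc] noloop.
rewrite -!dim_loc_const.
rewrite (ltn_leqif (dimv_leqif_sup (loc_constS (subsetDl _ _)))).
pose indicator : potential := [ffun w => (w == v)%:R%R].
apply: contra noloop => /subvP/(_ indicator) h.
have /h/loc_constP/(_ e eJ) : indicator \in loc_const (J :\: star J v).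
  apply/loc_constP=> e'; rewrite !inE => /andP[+ e'J]; rewrite e'J /=.
  by rewrite !ffunE negb_or => /andP[/negPf-> /negPf->].
rewrite !ffunE /is_loop; case/orP: inc => /eqP->; rewrite eqxx ?[v == _]eq_sym;
  by case: (_ == v).
Qed.

Definition graphic_rank J : nat := #|vertex G| - ncomp J.

Lemma graphic_rank0 : graphic_rank set0 = 0.
Proof. by rewrite /graphic_rank ncomp0 subnn. Qed.

Lemma polymatroid_graphic_rank : polymatroid graphic_rank.
Proof.
split=> [|J K /ncompS|J K]; [exact: graphic_rank0 | exact: leq_sub2l |].
have := ncomp_supermod J K; rewrite /graphic_rank.
have := (ncomp_le J, ncomp_le K, ncomp_le (J :|: K), ncomp_le (J :&: K)).
by move=> [[[]]]; lia.
Qed.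

End Components.

Section SpanningTrees.
Variable G : mgraph.
Implicit Types (F T : factor G) (x y u v : vertex G) (e : edge G).

Lemma connect_walk F x p :
  walk F x p -> connect (adjacent F) x (last x (unzip2 p)).
Proof.
elim: p x => //= -[e y] p IHp x /and3P[eF exy /IHp].
by apply/connect_trans/connect1/existsP; exists e; rewrite eF.
Qed.

Lemma walk_setD1 F e x p :
  e \notin unzip1 p -> walk F x p -> walk (F :\ e) x p.
Proof.
elim: p x => //= -[e' y] p IHp x /=; rewrite inE negb_or => /andP[ne ep].
by case/and3P=> e'F -> /(IHp _ ep)->; rewrite !inE e'F eq_sym ne.
Qed.

Lemma connected_setD1 F e x y : joins e x y ->
  connect (adjacent (F :\ e)) x y -> connected F -> connected (F :\ e).
Proof.
move=> exy cxy cF u v; move: (cF u v); apply: connect_sub => a b.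
case/existsP=> e' /andP[e'F e'ab].
have [ee'|ne] := eqVneq e' e; last first.
  by apply: connect1; apply/existsP; exists e'; rewrite !inE ne e'F.
have cyx : connect (adjacent (F :\ e)) y x by rewrite connect_adjacent_sym.
move: e'ab exy; rewrite ee' /joins.
by case/orP=> /eqP-> /orP[] /eqP[-> ->].
Qed.

Lemma connected_spanning_tree F :
  connected F -> exists2 T : factor G, T \subset F & spanning_tree T.
Proof.
pose connb T := [forall u, forall v, connect (adjacent T) u v].
have connP T : reflect (connected T) (connb T) by apply: 'forall_forallP.
move/connP/minset_exists=> [T /minsetP[/connP cT minT] sTF].
exists T => //; split=> // x [|[e y] p] //; apply/negP.
case/and5P=> _ /= /and3P[eT exy wp] /eqP lastp /andP[ep _] _.
have cyx := connect_walk (walk_setD1 ep wp); rewrite lastp in cyx.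
have /connP/minT : connected (T :\ e).
  by apply: connected_setD1 exy _ cT; rewrite connect_adjacent_sym.
by move/(_ (subsetDl _ _))/setP/(_ e); rewrite !inE eqxx eT.
Qed.

Lemma tree_connectedI m F (T : 'I_m -> factor G) :
    (forall i, T i \subset F) -> (forall i, connected (T i)) ->
    (forall i j, i != j -> [disjoint T i & T j]) ->
  tree_connected m F.
Proof.
move=> sTF connT disT.
have /fin_all_exists2[T' sT' treeT'] i := connected_spanning_tree (connT i).
exists T'; split=> [i|i j /disT]; first by rewrite (subset_trans (sT' i)).
by move/(disjointWl (sT' i))/(disjointWr (sT' j)).
Qed.

End SpanningTrees.

Section Tails.
Variable G : mgraph.
Implicit Types (F : factor G) (t : edge G -> vertex G) (l : vertex G -> int).

Definition orient_from t e : vertex G * vertex G :=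
  (t e, if (ends e).1 == t e then (ends e).2 else (ends e).1).

Lemma orientation_orient_from F t :
  (forall e, e \in F -> incident e (t e)) -> orientation F (orient_from t).
Proof.
move=> inc e /inc; rewrite /joins /incident /=.
case: eqP => [<- _|_ /= /eqP <-]; first by rewrite -surjective_pairing eqxx.
by rewrite -surjective_pairing eqxx orbT.
Qed.

Lemma tree_connected0 F : tree_connected 0 F.
Proof. by exists (fun=> set0); split=> -[]. Qed.

Lemma partition_connected0I F t l :
    (forall e, e \in F -> incident e (t e)) ->
    (forall v, (l v <= #|[set e in F | t e == v]|%:Z)%R) ->
  partition_connected 0 l F.
Proof.
move=> inc le_l; exists set0, F; split; first by rewrite set0U.
- by rewrite disjoints_subset sub0set.
- exact: tree_connected0.
by exists (orient_from t); split=> //; apply: orientation_orient_from.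
Qed.

Lemma partition_connectedW m F l l' :
    (forall v, (l' v <= l v)%R) ->
  partition_connected m l F -> partition_connected m l' F.
Proof.
move=> le [A [B [AB dis tc [D [oD dD]]]]]; exists A, B; split=> //.
by exists D; split=> // v; apply: Order.POrderTheory.le_trans (le v) (dD v).
Qed.

End Tails.

Section Packing.
Variables (G : mgraph) (m : nat) (l : vertex G -> nat) (M M0 : factor G).
Implicit Types (J : factor G) (v : vertex G) (e : edge G).

Hypothesis disMM0 : [disjoint M & M0].
Hypothesis packing_bound : forall J, [disjoint J & M0] ->
  #|J| + #|M0| + m * ncomp J + \sum_(v | isolated (J :\: M) v) l v
    <= #|edge G| + m.

(* An edge goes to one of the m future trees, or becomes an outgoing edge of
   one of its ends, or is left over. *)
Let part := option ('I_m + vertex G).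

Definition spare : nat := #|edge G| + m - (m * #|vertex G| + \sum_v l v).

Definition part_rank (k : part) J : nat :=
  match k with
  | Some (inl _) => graphic_rank (J :\: M0)
  | Some (inr v) => l v * meets (star (~: (M :|: M0)) v) J
  | None => spare * meets setT J
  end.

Definition capacity (k : part) : nat :=
  match k with
  | Some (inl _) => #|vertex G| - 1
  | Some (inr v) => l v
  | None => spare
  end.

Lemma polymatroid_part_rank k : polymatroid (part_rank k).
Proof.
case: k => [[i|v]|]; [|exact: polymatroid_meets..].
exact/polymatroid_setD/polymatroid_graphic_rank.
Qed.

Lemma part_rank_le_capacity k J : part_rank k J <= capacity k.
Proof.
case: k => [[i|v]|] /=; [|by rewrite -[leqRHS]muln1 leq_mul // leq_b1..].
have [Vgt0|] := ltnP 0 #|vertex G|; last by rewrite /graphic_rank; lia.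
by case/card_gt0P: Vgt0 => v _; apply/leq_sub2l/(ncomp_gt0 _ v).
Qed.

Lemma packing_bound0 : m * #|vertex G| + \sum_v l v <= #|edge G| + m.
Proof.
have := @packing_bound set0; rewrite disjoints_subset sub0set => /(_ isT).
rewrite cards0 ncomp0 (eq_bigl xpredT); first by lia.
by move=> v; apply/isolatedP=> e; rewrite !inE andbF.
Qed.

Lemma sum_capacity v : \sum_k capacity k = #|edge G|.
Proof.
rewrite sum_option big_sumType /= sum_nat_const card_ord mulnBr muln1 /spare.
have : m <= m * #|vertex G| by rewrite leq_pmulr //; apply/card_gt0P; exists v.
have := packing_bound0; set nE := #|edge G|; set nV := #|vertex G|; lia.
Qed.

Lemma card_le_sum_part_rank J : #|J| <= \sum_k part_rank k J.
Proof.
have [->|[e eJ]] := set_0Vmem J; first by rewrite cards0.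
have meetsJ : meets setT J by rewrite /meets setTI; apply/set0Pn; exists e.
rewrite sum_option big_sumType /= sum_nat_const card_ord meetsJ muln1.
have bound : #|J :\: M0| + #|M0| + m * ncomp (J :\: M0) +
    \sum_(v | isolated (J :\: M0 :\: M) v) l v <= #|edge G| + m.
  by apply: packing_bound; rewrite disjoints_subset subsetDr.
have split_l : \sum_v l v = \sum_v l v * meets (star (~: (M :|: M0)) v) J +
    \sum_(v | isolated (J :\: M0 :\: M) v) l v.
  rewrite [X in _ + X]big_mkcond -big_split; apply: eq_bigr => v _ /=.
  rewrite meets_star setDDl setUC setDE.
  by case: isolated; rewrite ?muln0 ?muln1 ?addn0.
have le_card : #|J| <= #|J :\: M0| + #|M0|.
  by rewrite -(cardsID M0 J) addnC leq_add2l subset_leq_card // subsetIr.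
have le_ncomp : m * ncomp (J :\: M0) <= m * #|vertex G|.
  by rewrite leq_mul2l ncomp_le orbT.
have := packing_bound0; rewrite /graphic_rank /spare mulnBr.
by move: bound split_l le_card le_ncomp; lia.
Qed.

Section Assignment.
Variable c : edge G -> part.
Hypothesis card_le_part_rank :
  forall k J, J \subset c @^-1: [set k] -> #|J| <= part_rank k J.

Let tree (i : 'I_m) : factor G := c @^-1: [set Some (inl i)].

Lemma part_rank_gt0 e : 0 < part_rank (c e) [set e].
Proof.
by rewrite -[leqLHS](cards1 e) card_le_part_rank // sub1set !inE.
Qed.

Lemma tree_notin_M0 i e : c e = Some (inl i) -> e \notin M0.
Proof.
move=> ce; have := part_rank_gt0 e; rewrite ce /=.
apply: contraTN => eM0; rewrite (_ : _ :\: _ = set0) ?graphic_rank0 //.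
by apply/eqP; rewrite setD_eq0 sub1set.
Qed.

Lemma tail_notin v e : c e = Some (inr v) -> e \notin M :|: M0 /\ incident e v.
Proof.
move=> ce; have := part_rank_gt0 e; rewrite ce /= muln_gt0 => /andP[_].
rewrite lt0b => /set0Pn[e' /setIP[+ /set1P e'E]].
by rewrite e'E !inE => /andP.
Qed.

Lemma card_part v k : #|c @^-1: [set k]| = capacity k.
Proof.
move: k; apply: eq_of_leq_sum => [k|].
  exact: leq_trans (card_le_part_rank _) (part_rank_le_capacity _ _).
by rewrite sum_card_fibers (sum_capacity v).
Qed.

Lemma connected_tree i : connected (tree i).
Proof.
move=> u v; apply: ncomp_le1_connected.
have := card_le_part_rank (subxx (tree i)); rewrite (card_part v) /=.
have := ncompS (subsetDl (tree i) M0); have := ncomp_le (tree i :\: M0).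
have : 0 < #|vertex G| by apply/card_gt0P; exists v.
by rewrite /graphic_rank; set nV := #|vertex G|; lia.
Qed.

Definition outgoing : factor G := [set e | [exists v, c e == Some (inr v)]].

Lemma outgoingP e :
  reflect (exists v, c e = Some (inr v)) (e \in outgoing).
Proof.
by rewrite inE; apply: (iffP existsP) => -[v ce]; exists v; apply/eqP.
Qed.

Lemma disjoint_outgoing (B : factor G) :
  B \subset M :|: M0 -> [disjoint outgoing & B].
Proof.
move=> sB; apply: disjointWr sB _; rewrite disjoints_subset.
by apply/subsetP=> e /outgoingP[v /tail_notin[+ _]]; rewrite in_setC.
Qed.

Lemma tree_connected_setC_outgoing : tree_connected m (~: (outgoing :|: M0)).
Proof.
apply: (tree_connectedI (T := tree)) => [i||i j].
- apply/subsetP=> e; rewrite !inE => /eqP ce.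
  by rewrite negb_or (tree_notin_M0 ce) andbT ce; apply/existsP=> -[].
- exact: connected_tree.
apply: contraR; rewrite -setI_eq0 => /set0Pn[e].
by rewrite !inE => /andP[/eqP-> /eqP[->]].
Qed.

Lemma partition_connected_outgoing :
  partition_connected 0 (fun v => (l v)%:Z%R) outgoing.
Proof.
pose tail e := if c e is Some (inr v) then v else (ends e).1.
apply: (partition_connected0I (t := tail)) => [e /outgoingP[v ce]|v].
  by rewrite /tail ce; case: (tail_notin ce).
rewrite -[l v]/(capacity (Some (inr v))) -(card_part v) lez_nat.
apply/subset_leq_card/subsetP=> e; rewrite !inE => /eqP ce.
by rewrite /tail ce eqxx andbT; apply/existsP; exists v.
Qed.

End Assignment.

Theorem tree_connected_factor_and_orientation : exists H : factor G,
  [/\ tree_connected m H, M \subset H, [disjoint H & M0] &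
      partition_connected 0 (fun v => (l v)%:Z%R) (~: (H :|: M0))].
Proof.
have [c rankc] :=
  polymatroid_partition polymatroid_part_rank card_le_sum_part_rank.
have disM := disjoint_outgoing rankc (subsetUl M M0).
have disM0 := disjoint_outgoing rankc (subsetUr M M0).
exists (~: (outgoing c :|: M0)); split.
- exact: tree_connected_setC_outgoing rankc.
- rewrite -disjoints_subset -setI_eq0 setIUr setU_eq0 !setI_eq0 disMM0 andbT.
  by rewrite disjoint_sym.
- by rewrite disjoints_subset setCS subsetUr.
have -> : ~: (~: (outgoing c :|: M0) :|: M0) = outgoing c.
  by rewrite setCU setCK -setDE setDUl setDv setU0; apply/setDidPl.
exact: partition_connected_outgoing rankc.
Qed.

End Packing.

Section Degrees.
Variable G : mgraph.
Implicit Types (J : factor G) (B : {pred vertex G}) (v : vertex G) (e : edge G).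

Definition cut B : factor G :=
  [set e | ((ends e).1 \in B) != ((ends e).2 \in B)].

Lemma edge_connected_card_cut k B u v :
  edge_connected G k -> u \in B -> v \notin B -> k <= #|cut B|.
Proof.
move=> conn uB; apply: contraR; rewrite -ltnNge => /conn/(_ u v) cuv.
rewrite -(closed_connect _ cuv) // => x y /adjacentP[e].
by rewrite !inE negbK => /eqP + [] E; rewrite E.
Qed.

Lemma sum_degree J B :
  \sum_(v in B) degree J v =
  \sum_(e in J) (((ends e).1 \in B) + ((ends e).2 \in B)).
Proof.
have sum_eq u : \sum_(v in B) (u == v) = (u \in B).
  rewrite -big_mkcondr (eq_bigl (fun v => (v == u) && (u \in B))).
    by rewrite big_mkcondr big_pred1_eq; case: (u \in B).
  by move=> v; rewrite eq_sym; case: eqP => [->|_]; rewrite ?andbT ?andbF.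
rewrite exchange_big; apply: eq_bigr => e _ /=.
by rewrite big_split /= !sum_eq.
Qed.

Lemma card_cut_le_degree J B :
  cut B \subset J -> #|cut B| <= \sum_(v in B) degree J v.
Proof.
move=> /setIidPr cutJ; rewrite sum_degree (big_setID (cut B)) /= cutJ.
apply: leq_trans (leq_addr _ _); rewrite -sum1_card; apply: leq_sum => e.
by rewrite inE; do 2!case: (_ \in B).
Qed.

Lemma handshake J : \sum_v degree J v = 2 * #|J|.
Proof.
rewrite (eq_bigl (mem predT)) // sum_degree.
by rewrite (eq_bigr (fun=> 2)) // sum_nat_const mulnC.
Qed.

Lemma degree_setC J v : degree J v + degree (~: J) v = degree [set: edge G] v.
Proof.
rewrite /degree [RHS](bigID (mem J)) /=.
by congr addn; apply: eq_bigl => e; rewrite !inE.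
Qed.

Lemma degree_isolated J v : isolated J v -> degree J v = 0.
Proof.
move=> /isolatedP Jv; apply: big1 => e /Jv.
by rewrite /incident negb_or => /andP[/negPf-> /negPf->].
Qed.

Lemma card_star_le_degree J v : #|star J v| <= degree J v.
Proof.
rewrite -sum1dep_card big_mkcondr; apply: leq_sum => e _.
by rewrite /incident; do 2!case: (_ == v).
Qed.

Lemma edge_connected_component_degree k J r :
    edge_connected G k -> 1 < ncomp J -> r \in roots (adjacent J) ->
  k <= \sum_(v | fingraph.root (adjacent J) v == r) degree (~: J) v.
Proof.
move=> conn gt1 rR; pose B := [pred v | fingraph.root (adjacent J) v == r].
have /card_gt0P[u] : 0 < #|[predD1 roots (adjacent J) & r]|.
  by move: gt1; rewrite /ncomp (cardD1 r) rR.
rewrite !inE => /andP[ur /eqP uR].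
have uB : u \notin B by rewrite inE uR.
have rB : r \in B by rewrite inE.
apply: leq_trans (edge_connected_card_cut conn rB uB) _.
apply: (card_cut_le_degree (B := B)); apply/subsetP=> e; rewrite !inE.
by apply: contra => eJ; rewrite (root_ends eJ).
Qed.

Lemma edge_connected_sum_degree k J : edge_connected G k -> 1 < ncomp J ->
  k * ncomp J + \sum_(v | isolated J v) (degree [set: edge G] v - k)
    <= 2 * #|~: J|.
Proof.
move=> conn gt1; pose rootJ := fingraph.root (adjacent J).
have isolated_roots r :
    (r \in roots (adjacent J)) && isolated J r = isolated J r.
  by rewrite andb_idl // => /root_isolated/eqP.
rewrite mulnC -sum_nat_const -(eq_bigl _ _ isolated_roots).
rewrite [X in _ + X]big_mkcondr -big_split -handshake.
rewrite [leqRHS](partition_big rootJ [in roots (adjacent J)]) => [|v _].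
  apply: leq_sum => r rR /=.
  have := edge_connected_component_degree conn gt1 rR.
  case: ifP => [isor|_]; last by rewrite addn0.
  rewrite -maxnE geq_max => -> /=.
  rewrite -(degree_setC J r) degree_isolated // add0n (bigD1 r) //=.
  exact: leq_addr.
exact: root_in_roots.
Qed.

(* Isolating a vertex of J-degree at most m creates a component, which pays
   for the deleted edges. *)
Lemma card_ncomp_isolate m J v :
    loopless (star J v) -> #|star J v| <= m ->
  #|J| + m * ncomp J <= #|J :\: star J v| + m * ncomp (J :\: star J v).
Proof.
move=> noloop le_m.
have [-> | [e eS]] := set_0Vmem (star J v); first by rewrite setD0.
have lt_ncomp := ncomp_isolate eS (noloop e eS).
have -> : #|J| = #|star J v| + #|J :\: star J v|.
  by rewrite -[LHS](cardsID (star J v)) (setIidPr (star_sub J v)).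
rewrite [#|star _ _| + _]addnC -addnA leq_add2l.
apply: leq_trans (leq_add le_m (leqnn _)) _.
by rewrite -mulnS leq_mul2l lt_ncomp orbT.
Qed.

Lemma isolate_covered m (M J : factor G) :
    loopless M -> max_degree M <= m ->
  exists J' : factor G,
    [/\ J' \subset J, isolated J' =1 isolated (J :\: M) &
        #|J| + m * ncomp J <= #|J'| + m * ncomp J'].
Proof.
move=> noloop le_m; have [k] := ubnP #|J|; elim: k => // k IHk in J * => ltk.
have [v /andP[isoM niso]|done] :=
  pickP (fun v => isolated (J :\: M) v && ~~ isolated J v); last first.
  exists J => //; split=> // v; apply/idP/idP; first exact/isolatedS/subsetDl.
  by move=> isoM; move: (done v); rewrite isoM => /negbFE.
have starM : star J v \subset star M v.
  apply/subsetP=> e; rewrite !inE => /andP[eJ inc]; rewrite inc andbT.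
  by apply: contraTT inc => eM; apply: (isolatedP _ _ isoM); rewrite inE eM.
have star_le_m : #|star J v| <= m.
  apply: leq_trans (subset_leq_card starM) _.
  apply: leq_trans (card_star_le_degree M v) _.
  exact: leq_trans (leq_bigmax v) le_m.
have star_noloop : loopless (star J v).
  by move=> e /(subsetP starM)/(subsetP (star_sub M v))/noloop.
have lt_card : #|J :\: star J v| < k.
  have := cardsID (star J v) J; rewrite (setIidPr (star_sub J v)).
  by move: niso ltk; rewrite /isolated -card_gt0; lia.
have [J' [sJ' isoJ' leJ']] := IHk _ lt_card; exists J'; split=> [|w|].
- exact: subset_trans sJ' (subsetDl _ _).
- rewrite isoJ' setDDl (setUidPr _) //.
  exact: subset_trans starM (star_sub M v).
exact: leq_trans (card_ncomp_isolate star_noloop star_le_m) leJ'.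
Qed.

End Degrees.

Section HalfDegreeDemand.
Variables (G : mgraph) (m : nat).
Implicit Types (M J : factor G) (z : option (vertex G)) (v : vertex G).

Definition half_degree z v : nat :=
  if Some v == z then uphalf (degree [set: edge G] v)
  else (degree [set: edge G] v)./2.

(* Truncated at 0, where the requirement on the out-degree is void. *)
Definition demand z v : nat := half_degree z v - m.

Hypothesis conn : edge_connected G (2 * m).

Lemma double_demand_le z v :
  2 * demand z v <= degree [set: edge G] v - 2 * m + (Some v == z).
Proof. by rewrite /demand /half_degree; case: eqP => _; lia. Qed.

Lemma double_sum_demand_le z (P : pred (vertex G)) :
  2 * \sum_(v | P v) demand z v <=
  \sum_(v | P v) (degree [set: edge G] v - 2 * m) + 1.
Proof.
apply: (@leq_trans (\sum_(v | P v)
   (degree [set: edge G] v - 2 * m + (Some v == z)))).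
  by rewrite big_distrr /=; apply: leq_sum => v _; apply: double_demand_le.
rewrite big_split leq_add2l /= -big_mkcondr sum1dep_card.
apply/card_le1_eqP => u v; rewrite !inE => /andP[_ /eqP<-] /andP[_].
by move/eqP=> -[->].
Qed.

(* The odd unit gained by rounding up at z is lost to parity. *)
Lemma ncomp_demand_le z J : 1 < ncomp J ->
  m * ncomp J + \sum_(v | isolated J v) demand z v <= #|~: J|.
Proof.
move=> /(edge_connected_sum_degree conn).
have := double_sum_demand_le z (isolated J); lia.
Qed.

Lemma connected_demand_le z M0 J :
    loopless M0 -> [disjoint J & M0] -> connected J ->
  #|J| + #|M0| + \sum_(v | isolated J v) demand z v <= #|edge G|.
Proof.
move=> noloop dis connJ.
have [v isov|no_isolated] := pickP (isolated J); last first.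
  rewrite big_pred0 // addn0 -cardsUI disjoint_setI0 // cards0 addn0.
  exact: max_card.
have only u : u = v by apply: connect_isolated (connJ u v).
have J0 : J = set0.
  apply/eqP; rewrite -subset0; apply/subsetP=> e eJ.
  by have /isolatedP/(_ e eJ) := isov; rewrite /incident (only (ends e).1) eqxx.
have M00 : M0 = set0.
  apply/eqP; rewrite -subset0; apply/subsetP=> e /noloop.
  by rewrite /is_loop (only (ends e).1) (only (ends e).2) eqxx.
have -> : \sum_(u | isolated J u) demand z u = demand z v.
  by apply: big_pred1 => u; rewrite (only u) isov /= eqxx.
have dv : degree [set: edge G] v = 2 * #|edge G|.
  rewrite -cardsT -handshake; apply/esym/big_pred1 => u.
  by rewrite (only u) /= eqxx.
by rewrite J0 M00 !cards0 /demand /half_degree dv; case: eqP => _; lia.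
Qed.

Lemma packing_bound_demand z M M0 J :
    loopless M -> loopless M0 -> max_degree M <= m -> #|M0| <= m ->
    [disjoint J & M0] ->
  #|J| + #|M0| + m * ncomp J + \sum_(v | isolated (J :\: M) v) demand z v
    <= #|edge G| + m.
Proof.
move=> loopM loopM0 degM cardM0 dis.
have [J' [sJ' isoJ' leJ']] := isolate_covered J loopM degM.
rewrite -(eq_bigl _ _ isoJ').
suff : #|J'| + #|M0| + m * ncomp J' + \sum_(v | isolated J' v) demand z v
    <= #|edge G| + m by move: leJ'; lia.
have {}dis : [disjoint J' & M0] := disjointWl sJ' dis.
have [gt1|le1] := ltnP 1 (ncomp J').
  by have := ncomp_demand_le z gt1; have := cardsC J'; move: cardM0; lia.
have := connected_demand_le z loopM0 dis (ncomp_le1_connected le1).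
have : m * ncomp J' <= m by rewrite -[leqRHS]muln1 leq_mul.
lia.
Qed.

End HalfDegreeDemand.

Theorem theorem2p4 (m : nat) (G : mgraph) (M M0 : factor G)
    (hM : loopless M) (hM0 : loopless M0) (hdisj : [disjoint M & M0])
    (hdeg : max_degree M <= m) (hcard : #|M0| <= m)
    (hconn : edge_connected G (2 * m)) :
  (exists H : factor G,
    [/\ tree_connected m H, M \subset H, [disjoint H & M0] &
        partition_connected 0
          (fun v => ((degree [set: edge G] v)./2%:Z - m%:Z)%R)
          (~: (H :|: M0))]) /\
  (forall z : vertex G, exists H : factor G,
    [/\ tree_connected m H, M \subset H, [disjoint H & M0] &
        partition_connected 0
          (fun v => ((if v == z then uphalf (degree [set: edge G] v)
                      else (degree [set: edge G] v)./2)%:Z - m%:Z)%R)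
          (~: (H :|: M0))]).
Proof.
have packing z : exists H : factor G,
    [/\ tree_connected m H, M \subset H, [disjoint H & M0] &
        partition_connected 0 (fun v => ((half_degree z v)%:Z - m%:Z)%R)
          (~: (H :|: M0))].
  have bound J := packing_bound_demand hconn z hM hM0 hdeg hcard (J := J).
  have [H [treeH MH HM0 outH]] :=
    tree_connected_factor_and_orientation hdisj bound.
  exists H; split=> //; apply: partition_connectedW outH => v.
  by rewrite /demand; lia.
by split=> [|z]; [apply: (packing None) | apply: (packing (Some z))].
Qed.
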